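(* Consider the bi-objective problem $\min_{x\in S}f(x)$ with tolerances $\delta_1,\delta_2>0$, and assume that its Pareto Front $\mathcal P$ is a continuous and compact curve in $\mathbb R^2$. Then the ROBBO algorithm (described in the context) always terminates after at most $$\underline M_c=\left\lceil\frac14\left(\frac{\Delta_1}{\delta_1}+\frac{\Delta_2}{\delta_2}\right)\right\rceil+1$$ iterations (including the two iterations that compute the anchor points), and its output $\hat{\mathcal P}_c$, paired with the realization $\mathcal R_{SM}$, satisfies the robustness guarantee: for every $\hat z\in\hat{\mathcal P}_c$, with $z^*=\mathcal R_{SM}(\hat z)\in\mathcal P$ and $\varepsilon=\hat z-z^*$, one has $|\varepsilon_1|<\delta_1$ and $|\varepsilon_2|<\delta_2$.
   Context: Setting. $f=(f_1,f_2):\mathbb R^n\to\mathbb R^2$, $S\subset\mathbb R^n$, $Z=\{f(x):x\in S\}$. A point $z^{(1)}\in Z$ dominates $z^{(2)}\in Z$ iff $z^{(2)}-z^{(1)}$ is nonzero with non-negative entries; the Pareto Front (PF) $\mathcal P$ is the set of non-dominated points of $Z$. The anchor points $z^{*(a1)},z^{*(a2)}\in\mathcal P$ are the PF points minimizing $f_1$, resp. $f_2$, over $S$ (assumed distinct), and $\Delta_1=z_1^{*(a2)}-z_1^{*(a1)}$, $\Delta_2=z_2^{*(a1)}-z_2^{*(a2)}$. Transformation. $$W=\frac{\sqrt2}{2}\begin{bmatrix}1&-1\\1&1\end{bmatrix}\begin{bmatrix}1/\delta_1&0\\0&1/\delta_2\end{bmatrix},\qquad [z_v,z_q]^T=Wz\text{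 for }z\in\mathbb R^2.$$ Under the assumption on $\mathcal P$, $\mathcal P=\{W^{-1}[v,h(v)]^T:v\in[z_v^{*(a1)},z_v^{*(a2)}]\}$ for a continuous function $h:[z_v^{*(a1)},z_v^{*(a2)}]\to\mathbb R$. Bounds. For a finite set $\mathcal D\subset\mathcal P$ containing the anchor points, ordered by increasing $v$-coordinate, and for $v\in[z_v^{*(a1)},z_v^{*(a2)}]$, let $z^{*(j^-)}(v)$ (resp. $z^{*(j^+)}(v)$) be the sample in $\mathcal D$ with largest $v$-coordinate $\le v$ (resp. smallest $v$-coordinate $\ge v$). Put $$\bar h_{\mathcal D}(v)=\min_{z\in\{z^{*(j^-)}(v),z^{*(j^+)}(v)\}}(z_q+|v-z_v|),\quad \underline h_{\mathcal D}(v)=\max_{z\in\{z^{*(j^-)}(v),z^{*(j^+)}(v)\}}(z_q-|v-z_v|),$$ $\overline\lambda_{\mathcal D}=\max_{v}(\bar h_{\mathcal D}(v)-\underline h_{\mathcal D}(v))$, $\hat h_c=\frac12(\bar h_{\mathcal D}+\underline h_{\mathcal D})$ and $\hat{\mathcal P}_c=\{W^{-1}[v,\hat h_c(v)]^T:v\in[z_v^{*(a1)},z_v^{*(a2)}]\}$ (the central estimate). Realization. $\mathcal R_{SM}(\hat z)=W^{-1}[\hat z_v,h(\hat z_v)]^T$, the PF point with the same $v$-coordinate as $\hat z$. ROBBO algorithm. Iterations $k=1,2$ compute the anchor points. Set $\mathcal D^{\langle2\rangle}=\{z^{*(a1)},z^{*(a2)}\}$ and fix a grid of $\underline M_c-2$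 strictly increasing values $\tilde v^{(r)}$ in $[z_v^{*(a1)},z_v^{*(a2)}]$, equally spaced from one another and from the endpoints $z_v^{*(a1)},z_v^{*(a2)}$. While $\overline\lambda_{\mathcal D^{\langle k\rangle}}>2\sqrt2$: increase $k$ by one; choose a grid value $\tilde v^{\langle k\rangle}$ maximizing $\bar h_{\mathcal D}(\tilde v^{(r)})-\underline h_{\mathcal D}(\tilde v^{(r)})$ over $r$ with $\mathcal D=\mathcal D^{\langle k-1\rangle}$ (ties: take the value farthest in $v$-coordinate from the already collected samples, then the smallest); compute the PF point $z^{\langle k\rangle}=W^{-1}[\tilde v^{\langle k\rangle},h(\tilde v^{\langle k\rangle})]^T$, obtained as $f(x^* )$ where $x^*$ minimizes $\delta_1f_1(x)+\delta_2f_2(x)$ over $x\in S$ subject to $\delta_2f_1(x)-\delta_1f_2(x)-\frac{2\delta_1\delta_2}{\sqrt2}\tilde v^{\langle k\rangle}=0$ (taken, as in the paper, to return the PF point with $v$-coordinate $\tilde v^{\langle k\rangle}$); and set $\mathcal D^{\langle k\rangle}=\mathcal D^{\langle k-1\rangle}\cup\{z^{\langle k\rangle}\}$. When the loop ends, return $\hat{\mathcal P}_c$ for $\mathcal D=\mathcal D^{\langle k\rangle}$. *)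

(* Defs.v *)
From HB Require Import structures.
From mathcomp Require Import all_boot all_order all_algebra.
From mathcomp Require Import all_classical all_reals all_analysis.

Set Implicit Arguments.
Unset Strict Implicit.
Unset Printing Implicit Defensive.

Import Order.TTheory GRing.Theory Num.Theory.
Import numFieldNormedType.Exports.

Local Open Scope classical_set_scope.
Local Open Scope ring_scope.

(* Points of R^n are column vectors; the
   components z_1, z_2 of z : 'cV_2 are z 0 0 and z 1 0. *)

Section BiObjective.
Context {R : realType} {n : nat}.
Variables (f : 'cV[R]_n -> 'cV[R]_2) (S : set 'cV[R]_n).
Implicit Types z : 'cV[R]_2.

Definition dominates z z' : Prop := z' - z != 0 /\ forall i, 0 <= (z' - z) i 0.

Definition pareto_front : set 'cV[R]_2 :=
  [set z | (f @` S) z /\ ~ exists2 z', (f @` S) z' & dominates z' z].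

(* z is the anchor point of the i-th objective *)
Definition anchor (i : 'I_2) z : Prop :=
  pareto_front z /\ forall x, S x -> z i 0 <= f x i 0.

End BiObjective.

(* The parameter interval is arbitrary (not necessarily closed or bounded), and
   the parametrization need not be injective. *)
Definition continuous_compact_curve {R : realType} (P : set 'cV[R]_2) : Prop :=
  compact P /\
  exists (I : interval R) (gamma : R -> 'cV[R]_2),
    {within [set` I], continuous gamma} /\ P = gamma @` [set` I].

Section Transformation.
Context {R : realType}.
Variables delta1 delta2 : R.
Implicit Types (z : 'cV[R]_2) (v q : R) (P D : set 'cV[R]_2).

Definition W : 'M[R]_2 :=
  (Num.sqrt 2 / 2) *:
    ((\matrix_(i < 2, j < 2) (if (i == 0) && (j == 1) then -1 else 1)) *m
     diag_mx (\row_(j < 2) (if j == 0 then delta1^-1 else delta2^-1))).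

Definition vcoord z : R := (W *m z) 0 0.
Definition qcoord z : R := (W *m z) 1 0.

Definition of_vq v q : 'cV[R]_2 :=
  invmx W *m \col_(i < 2) (if i == 0 then v else q).

(* Two distinct points of a Pareto front P have distinct v-coordinates, so at
   most one q qualifies. *)
Definition pf_height P v : R := xget 0 [set q | P (of_vq v q)].

Definition realization P z : 'cV[R]_2 :=
  of_vq (vcoord z) (pf_height P (vcoord z)).

(* z^{*(j^-)}(v) and z^{*(j^+)}(v) *)
Definition left_sample D v : 'cV[R]_2 :=
  xget 0 [set z | [/\ D z, vcoord z <= v &
    forall z', D z' -> vcoord z' <= v -> vcoord z' <= vcoord z]].
Definition right_sample D v : 'cV[R]_2 :=
  xget 0 [set z | [/\ D z, v <= vcoord z &
    forall z', D z' -> v <= vcoord z' -> vcoord z <= vcoord z']].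

Definition upper_bound D v : R :=
  let u z := qcoord z + `|v - vcoord z| in
  Num.min (u (left_sample D v)) (u (right_sample D v)).
Definition lower_bound D v : R :=
  let l z := qcoord z - `|v - vcoord z| in
  Num.max (l (left_sample D v)) (l (right_sample D v)).
Definition gap D v : R := upper_bound D v - lower_bound D v.
Definition central D v : R := (upper_bound D v + lower_bound D v) / 2.

(* distance, in v-coordinate, from v to the samples (a minimum, D being
   finite and nonempty) *)
Definition sample_dist D v : R := inf [set `|v - vcoord z| | z in D].

Section Anchors.
Variables a1 a2 : 'cV[R]_2.

Definition vrange : set R := `[vcoord a1, vcoord a2]%classic.

(* The supremum is attained, because gap D is continuous on the segment
   vrange. *)
Definition max_gap D : R := sup [set gap D v | v in vrange].

Definition central_estimate D : set 'cV[R]_2 :=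
  [set of_vq v (central D v) | v in vrange].

Definition Mc : int :=
  Num.ceil (4^-1 * ((a2 0 0 - a1 0 0) / delta1 + (a1 1 0 - a2 1 0) / delta2))
  + 1.

(* the interior points of the subdivision of vrange into Mc - 1 equal parts *)
Definition grid_value (r : nat) : R :=
  vcoord a1 + r%:R * ((vcoord a2 - vcoord a1) / (Mc - 1)%:~R).
Definition grid : set R :=
  [set grid_value r | r in [set r : nat | 1 <= r%:Z <= Mc - 2]].

Definition selected D v : Prop :=
  [/\ grid v,
      forall w, grid w -> gap D w <= gap D v,
      forall w, grid w -> gap D w = gap D v ->
        sample_dist D w <= sample_dist D v &
      forall w, grid w -> gap D w = gap D v ->
        sample_dist D w = sample_dist D v -> v <= w].

End Anchors.
End Transformation.

Section Algorithm.
Context {R : realType} {n : nat}.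
Variables (f : 'cV[R]_n -> 'cV[R]_2) (S : set 'cV[R]_n).
Variables (delta1 delta2 : R) (a1 a2 : 'cV[R]_2).

Definition subproblem_feasible (v : R) (x : 'cV[R]_n) : Prop :=
  S x /\ delta2 * f x 0 0 - delta1 * f x 1 0
         - 2 * delta1 * delta2 / Num.sqrt 2 * v = 0.

Definition subproblem_solution (v : R) (x : 'cV[R]_n) : Prop :=
  subproblem_feasible v x /\
  forall y, subproblem_feasible v y ->
    delta1 * f x 0 0 + delta2 * f x 1 0 <= delta1 * f y 0 0 + delta2 * f y 1 0.

Definition stopping_test (D : set 'cV[R]_2) : Prop :=
  max_gap delta1 delta2 a1 a2 D <= 2 * Num.sqrt 2.

(* One pass through the loop body, from the sample set D to D' *)
Definition robbo_step (D D' : set 'cV[R]_2) : Prop :=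
  ~ stopping_test D /\
  exists v x z,
    [/\ selected delta1 delta2 a1 a2 D v,
        subproblem_solution v x,
        z = f x,
        z = of_vq delta1 delta2 v
              (pf_height delta1 delta2 (pareto_front f S) v) &
        D' = D `|` [set z]].

(* robbo_run k D: some execution has sample set D after k iterations, the
   first two of which compute the anchor points *)
Inductive robbo_run : nat -> set 'cV[R]_2 -> Prop :=
| robbo_run_init : robbo_run 2 [set a1; a2]
| robbo_run_step k D D' :
    robbo_run k D -> robbo_step D D' -> robbo_run k.+1 D'.

(* Every execution stops, within N iterations and through the stopping test: no
   execution performs more than N iterations, and the loop body can be carried
   out whenever the test fails. *)
Definition robbo_terminates_within (N : int) : Prop :=
  (forall k D, robbo_run k D -> k%:Z <= N) /\
  (forall k D, robbo_run k D -> ~ stopping_test D -> exists D', robbo_step D D').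

Definition robbo_returns (Phat : set 'cV[R]_2) : Prop :=
  exists k D, [/\ robbo_run k D, stopping_test D &
                  Phat = central_estimate delta1 delta2 a1 a2 D].

End Algorithm.

(* Main.v *)
Require Import Defs.
From mathcomp Require Import all_boot all_order all_algebra.
From mathcomp Require Import all_classical all_reals all_analysis.
From mathcomp Require Import lra ring zify.

Import Order.TTheory GRing.Theory Num.Theory.
Import numFieldNormedType.Exports.

Local Open Scope classical_set_scope.
Local Open Scope ring_scope.

(** Two distinct points of a Pareto front are incomparable, so the q-coordinate
is a strictly 1-Lipschitz function of the v-coordinate on the front, and it is
defined on the whole range between the anchors because the front is connected.
Hence an unsampled front point lies strictly between the lower and upper
bounds, so the gap is positive there, whereas it vanishes at a sample. While
the stopping test fails some grid value is unsampled, and so a value of maximal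
gap on the grid is new; there are only [Mc - 2] of them. Once they are all
sampled, neighbouring samples are at most [2 * sqrt 2] apart, which bounds the
gap and forces the test to succeed. On termination the error of the central
estimate is less than half the gap, hence less than [sqrt 2]; it is parallel to
the q-axis, which [W^-1] turns into errors below [delta1] and [delta2]. *)

(** * Auxiliary facts: maxima over finite sets and the two indices *)

Lemma finite_set_argmax {T : eqType} {d} {U : orderType d} (g : T -> U)
    (A : set T) :
  finite_set A -> A !=set0 -> exists2 x, A x & forall y, A y -> (g y <= g x)%O.
Proof.
move=> /finite_seqP[s ->{A}] [x0 /=].
elim: s x0 => [//|x s IHs] x0 _.
case: s IHs => [_|y s IHs].
  by exists x => /=; [rewrite mem_seq1|move=> y; rewrite mem_seq1 => /eqP ->].
have [|m /= ms mP] := IHs y; first by rewrite mem_head.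
have [gxm|gmx] := leP (g x) (g m).
  exists m => /=; first by rewrite in_cons ms orbT.
  by move=> w; rewrite in_cons => /predU1P[->//|]; exact: mP.
exists x => /=; first exact: mem_head.
move=> w; rewrite in_cons => /predU1P[->//|/mP gwm].
exact: le_trans gwm (ltW gmx).
Qed.

Lemma ord2_cases (i : 'I_2) : i = 0 \/ i = 1.
Proof. by case: i => -[|[]]//= h; [left|right]; exact/val_inj. Qed.

(** * The rotated and scaled coordinates *)

Section Coordinates.
Context {R : realType} {d1 d2 : R}.
Hypotheses (d1_gt0 : 0 < d1) (d2_gt0 : 0 < d2).
Implicit Types (z : 'cV[R]_2) (v q : R).

Local Notation vcoord := (vcoord d1 d2).
Local Notation qcoord := (qcoord d1 d2).
Local Notation of_vq := (of_vq d1 d2).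

Lemma sqrt2_gt0 : 0 < Num.sqrt 2 :> R.
Proof. by rewrite sqrtr_gt0. Qed.

Lemma sqr_sqrt2 : Num.sqrt 2 * Num.sqrt 2 = 2 :> R.
Proof. by rewrite -expr2 sqr_sqrtr. Qed.

(** The number of columns is left free so that the formula applies both to points and to the
    candidate inverse of [W]. *)
Lemma W_mulE m (A : 'M[R]_(2, m)) i j :
  (W d1 d2 *m A) i j = (A 0 j / d1 + (-1) ^+ (i == 0) * A 1 j / d2) / Num.sqrt 2.
Proof.
rewrite /W -scalemxAl -mulmxA !mxE big_ord_recl big_ord1 !mxE /=.
rewrite !big_ord_recl !big_ord0 !mxE /= !mulr1n !mulr0n.
have -> : lift ord0 ord0 = 1 :> 'I_2 by exact/val_inj.
have -> : Num.sqrt 2 / 2 = (Num.sqrt 2)^-1 :> R.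
  by rewrite -[X in _ / X]sqr_sqrt2 invfM mulrA divff ?mul1r ?gt_eqF ?sqrt2_gt0.
by rewrite andbF andbT; case: (i == 0) => /=; ring.
Qed.

Lemma vcoordE z : vcoord z = (z 0 0 / d1 - z 1 0 / d2) / Num.sqrt 2.
Proof. by rewrite /vcoord W_mulE /= mulN1r mulNr. Qed.

Lemma qcoordE z : qcoord z = (z 0 0 / d1 + z 1 0 / d2) / Num.sqrt 2.
Proof. by rewrite /qcoord W_mulE /= mul1r. Qed.

Lemma W_unitmx : W d1 d2 \in unitmx.
Proof.
(* [B] is the inverse of the rotation followed by the scaling by [d1] and [d2]. *)
pose B : 'M[R]_2 := \matrix_(i, j)
  ((if i == 0 then d1 else (-1) ^+ (j == 0) * d2) / Num.sqrt 2).
suff /mulmx1_unit[] : W d1 d2 *m B = 1%:M by [].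
apply/matrixP => i j; rewrite W_mulE !mxE /=.
have s2 : (Num.sqrt 2)^-1 * (Num.sqrt 2)^-1 = 2^-1 :> R.
  by rewrite -invfM sqr_sqrt2.
have [->|->] := ord2_cases i.
- have [->|->] := ord2_cases j.
  + rewrite /=; transitivity (2 * ((Num.sqrt 2)^-1 * (Num.sqrt 2)^-1) : R).
      by field; rewrite !gt_eqF ?sqrt2_gt0.
    by rewrite s2 divff.
  + by rewrite /=; field; rewrite !gt_eqF ?sqrt2_gt0.
- have [->|->] := ord2_cases j.
  + by rewrite /=; field; rewrite !gt_eqF ?sqrt2_gt0.
  + rewrite /=; transitivity (2 * ((Num.sqrt 2)^-1 * (Num.sqrt 2)^-1) : R).
      by field; rewrite !gt_eqF ?sqrt2_gt0.
    by rewrite s2 divff.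
Qed.

Lemma of_vqK_v v q : vcoord (of_vq v q) = v.
Proof. by rewrite /vcoord /of_vq mulKVmx ?W_unitmx// mxE. Qed.

Lemma of_vqK_q v q : qcoord (of_vq v q) = q.
Proof. by rewrite /qcoord /of_vq mulKVmx ?W_unitmx// mxE. Qed.

Lemma vqcoordK z : of_vq (vcoord z) (qcoord z) = z.
Proof.
rewrite /of_vq /vcoord /qcoord -[RHS](mulKmx W_unitmx); congr (_ *m _).
apply/colP => i; rewrite mxE; case: ifPn => [/eqP->//|i0].
by congr (_ _ 0); apply/val_inj; case: i i0 => -[|[]].
Qed.

Lemma coord0_vq z : z 0 0 = d1 * (qcoord z + vcoord z) / Num.sqrt 2.
Proof.
rewrite qcoordE vcoordE -mulrDl !mulrA -[RHS]mulrA -invfM sqr_sqrt2.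
by field; rewrite !gt_eqF.
Qed.

Lemma coord1_vq z : z 1 0 = d2 * (qcoord z - vcoord z) / Num.sqrt 2.
Proof.
rewrite qcoordE vcoordE -mulrBl !mulrA -[RHS]mulrA -invfM sqr_sqrt2.
by field; rewrite !gt_eqF.
Qed.

(** With [v] shared, the coordinates of the difference are [d1] and [d2] times
    [(q - q') / Num.sqrt 2]; this is where the tolerance [2 * Num.sqrt 2] on the gap comes from. *)
Lemma of_vqB_lt v q q' : `|q - q'| < Num.sqrt 2 ->
  `|(of_vq v q - of_vq v q') 0 0| < d1 /\ `|(of_vq v q - of_vq v q') 1 0| < d2.
Proof.
move=> lt_q; have scaled_lt d : 0 < d -> `|d * (q - q') / Num.sqrt 2| < d.
  move=> d_gt0; rewrite !normrM (gtr0_norm d_gt0) [`|_^-1|]gtr0_norm ?invr_gt0 ?sqrt2_gt0//.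
  by rewrite ltr_pdivrMr ?sqrt2_gt0// ltr_pM2l.
have coord_sub i : (of_vq v q - of_vq v q') i 0 = of_vq v q i 0 - of_vq v q' i 0.
  by rewrite !mxE.
rewrite !coord_sub !coord0_vq !coord1_vq !of_vqK_v !of_vqK_q.
rewrite -!mulrBl -!mulrBr (_ : q + v - (q' + v) = q - q'); last by ring.
rewrite (_ : q - v - (q' - v) = q - q'); last by ring.
by split; exact: scaled_lt.
Qed.

Lemma vcoord_continuous : continuous vcoord.
Proof.
rewrite (funext vcoordE).
have coord_c i d : continuous (fun z : 'cV[R]_2 => z i 0 / d).
  move=> z; apply: (@continuousM R _ (fun z : 'cV[R]_2 => z i 0) (cst d^-1)).
    exact: coord_continuous.
  exact: cst_continuous.
move=> z; apply: (@continuousM R _ (fun z => z 0 0 / d1 - z 1 0 / d2)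
  (cst (Num.sqrt 2)^-1)); last exact: cst_continuous.
exact: (@continuousB _ _ _ _ _ _ (coord_c 0 d1 z) (coord_c 1 d2 z)).
Qed.

(** * Order structure of the Pareto front *)

Section Front.
Context {n : nat} {f : 'cV[R]_n -> 'cV[R]_2} {S : set 'cV[R]_n}.
Local Notation P := (pareto_front f S).

Lemma pareto_minimal z y : P z -> (f @` S) y ->
  y 0 0 <= z 0 0 -> y 1 0 <= z 1 0 -> y = z.
Proof.
move=> [_ ndom] Zy le0 le1; apply/eqP; apply: contrapT => /negP yz.
apply: ndom; exists y => //; split; first by rewrite subr_eq0 eq_sym.
move=> i; rewrite !mxE subr_ge0.
by have [->|->] := ord2_cases i.
Qed.

Lemma pareto_antitone z z' : P z -> P z' -> z != z' ->
  z 0 0 < z' 0 0 /\ z' 1 0 < z 1 0 \/ z' 0 0 < z 0 0 /\ z 1 0 < z' 1 0.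
Proof.
move=> Pz Pz' /eqP zz'.
have [le0|lt0] := leP (z 0 0) (z' 0 0).
  have lt1 : z' 1 0 < z 1 0.
    by rewrite ltNge; apply/negP => le1; apply: zz'; apply: pareto_minimal => //; case: Pz.
  left; split=> //; rewrite lt_neqAle le0 andbT; apply/eqP => eq0.
  by apply/zz'/esym/pareto_minimal => //; [case: Pz'|rewrite eq0|exact: ltW].
right; split=> //; rewrite ltNge; apply/negP => le1; apply/zz'/esym.
by apply: pareto_minimal (ltW lt0) le1 => //; case: Pz'.
Qed.

(** Let a and b be the differences of the scaled coordinates. Incomparability gives them strictly
    opposite signs, so |a + b| < |a - b|. *)
Lemma pareto_qcoord_lt z z' : P z -> P z' -> z != z' ->
  `|qcoord z - qcoord z'| < `|vcoord z - vcoord z'|.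
Proof.
move=> Pz Pz' zz'; rewrite !qcoordE !vcoordE -!mulrBl !normrM.
rewrite ltr_pM2r ?normr_gt0 ?invr_eq0 ?gt_eqF ?sqrt2_gt0//.
have div_lt (d a b : R) : 0 < d -> a < b -> a / d < b / d.
  by move=> d0; rewrite ltr_pM2r ?invr_gt0.
case: (pareto_antitone _ _ Pz Pz' zz').
  move=> [/(div_lt _ _ _ d1_gt0) h1 /(div_lt _ _ _ d2_gt0) h2].
  by rewrite (@ltr0_norm _ (_ - _ - (_ - _))) ; [rewrite ltr_norml; apply/andP; split; lra|lra].
move=> [/(div_lt _ _ _ d1_gt0) h1 /(div_lt _ _ _ d2_gt0) h2].
by rewrite (@gtr0_norm _ (_ - _ - (_ - _))) ; [rewrite ltr_norml; apply/andP; split; lra|lra].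
Qed.

Lemma pareto_vcoord_inj z z' : P z -> P z' -> vcoord z = vcoord z' -> z = z'.
Proof.
move=> Pz Pz' e; apply: contrapT => /eqP /(pareto_qcoord_lt _ _ Pz Pz').
by rewrite e subrr normr0 ltNge normr_ge0.
Qed.

(** At equal v, both original coordinates increase with q, so a smaller q would give a dominating
    point. *)
Lemma pareto_qcoord_min z y : P z -> (f @` S) y -> vcoord y = vcoord z ->
  qcoord z <= qcoord y.
Proof.
move=> Pz Zy e; rewrite leNgt; apply/negP => lt_q.
have yz : y = z.
  apply: pareto_minimal => //; rewrite ?(coord0_vq y) ?(coord0_vq z) ?(coord1_vq y) ?(coord1_vq z) e;
  by rewrite ler_pM2r ?invr_gt0 ?sqrt2_gt0// ler_pM2l// ltW// ?ltrD2r.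
by rewrite yz ltxx in lt_q.
Qed.

(** * The range of v-coordinates and the number of grid cells *)

Context {a1 a2 : 'cV[R]_2}.
Hypotheses (a1_anchor : anchor f S 0 a1) (a2_anchor : anchor f S 1 a2).

(** Since [a1] minimizes the first objective, any other front point has a larger first and a smaller
    second coordinate, hence a larger v; the argument for [a2] is symmetric. *)
Lemma anchor_vcoord_le z : P z -> vcoord a1 <= vcoord z <= vcoord a2.
Proof.
move=> Pz; have [[x Sx fx] _] := Pz.
have [P1 /(_ _ Sx)] := a1_anchor; have [P2 /(_ _ Sx)] := a2_anchor; rewrite fx => m2 m1.
have div_lt (d a b : R) : 0 < d -> a < b -> a / d < b / d.
  by move=> d0; rewrite ltr_pM2r ?invr_gt0.
apply/andP; split.
  have [->//|/(pareto_antitone _ _ P1 Pz)[]] := eqVneq a1 z; last by lra.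
  move=> [/(div_lt _ _ _ d1_gt0) h1 /(div_lt _ _ _ d2_gt0) h2].
  rewrite !vcoordE ler_pM2r ?invr_gt0 ?sqrt2_gt0//.
  by lra.
have [->//|/(pareto_antitone _ _ Pz P2)[]] := eqVneq z a2; last by lra.
move=> [/(div_lt _ _ _ d1_gt0) h1 /(div_lt _ _ _ d2_gt0) h2].
rewrite !vcoordE ler_pM2r ?invr_gt0 ?sqrt2_gt0//.
by lra.
Qed.

Hypothesis PF_curve : continuous_compact_curve P.

(** The front is a continuous image of an interval, hence connected; its image under [vcoord] is
    then an interval containing both anchor values. *)
Lemma pareto_vrange v : vrange d1 d2 a1 a2 v -> exists2 z, P z & vcoord z = v.
Proof.
case: PF_curve => _ [I [g [g_cont PE]]].
have cP : connected P.
  rewrite PE; apply: connected_continuous_connected => //.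
  exact/connected_intervalP/interval_is_interval.
have /connected_intervalP : connected (vcoord @` P).
  apply: connected_continuous_connected => //.
  exact/continuous_subspaceT/vcoord_continuous.
have [P1 _] := a1_anchor; have [P2 _] := a2_anchor.
rewrite /vrange /= in_itv /= => itvP vv.
by have [z Pz <-] := itvP _ _ (imageP vcoord P1) (imageP vcoord P2) v vv; exists z.
Qed.

(** This is the value of [realization] at every point with v-coordinate [v]. *)
Definition pf_point v := of_vq v (pf_height d1 d2 P v).

(** The choice made by [xget] is harmless: a height exists, and by injectivity of [vcoord] on the
    front it is the only one. *)
Lemma pf_pointE z : P z -> pf_point (vcoord z) = z.
Proof.
move=> Pz; rewrite /pf_point /pf_height.
case: xgetP => [q _ Pq|/(_ (qcoord z))]; last by rewrite /= vqcoordK.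
by apply: pareto_vcoord_inj => //; rewrite of_vqK_v.
Qed.

Lemma pf_point_front v : vrange d1 d2 a1 a2 v -> P (pf_point v).
Proof. by case/pareto_vrange => z Pz <-; rewrite pf_pointE. Qed.

Hypothesis a1_neq_a2 : a1 != a2.

(** Here [m] is the number of grid cells, and the bound says that a cell is at most [2 * Num.sqrt 2]
    long. *)
Lemma Mc_spec : exists m : nat, [/\ (0 < m)%N, Mc d1 d2 a1 a2 = m%:Z + 1 &
  vcoord a2 - vcoord a1 <= m%:R * (2 * Num.sqrt 2)].
Proof.
have [P1 _] := a1_anchor; have [P2 _] := a2_anchor.
have L_gt0 : vcoord a1 < vcoord a2.
  have /andP[_ L0] := anchor_vcoord_le a1 P1.
  rewrite lt_neqAle L0 andbT; apply: contra_neq a1_neq_a2.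
  exact: pareto_vcoord_inj.
rewrite /Mc; set x := _ * _.
(* The argument [x] of the ceiling is exactly the length of the range in units of
   [2 * Num.sqrt 2]. *)
have LE : vcoord a2 - vcoord a1 = x * (2 * Num.sqrt 2).
  rewrite /x !vcoordE -mulrBl; apply/(canLR (mulfK _)).
    by rewrite gt_eqF ?sqrt2_gt0.
  rewrite -!mulrA sqr_sqrt2; lra.
have x_gt0 : 0 < x.
  by move: L_gt0; rewrite -subr_gt0 LE pmulr_lgt0// mulr_gt0 ?sqrt2_gt0.
have := ceil_ge x; move: x_gt0; rewrite -ceil_gt0.
case: (Num.ceil x) => // m m_gt0 xm; exists m; split=> //.
by rewrite LE ler_pM2r// mulr_gt0 ?sqrt2_gt0.
Qed.

(** * Bounds derived from a finite sample of the front *)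

Section Samples.
Context {D : set 'cV[R]_2}.
Hypotheses (D_fin : finite_set D) (DP : D `<=` P) (Da1 : D a1) (Da2 : D a2).
Local Notation left_sample := (left_sample d1 d2 D).
Local Notation right_sample := (right_sample d1 d2 D).
Local Notation upper_bound := (upper_bound d1 d2 D).
Local Notation lower_bound := (lower_bound d1 d2 D).
Local Notation gap := (gap d1 d2 D).
Local Notation vrange := (vrange d1 d2 a1 a2).

Lemma left_sampleP v : (exists2 z, D z & vcoord z <= v) ->
  [/\ D (left_sample v), vcoord (left_sample v) <= v &
    forall z, D z -> vcoord z <= v -> vcoord z <= vcoord (left_sample v)].
Proof.
move=> [z0 Dz0 z0v]; suff /(xgetPex 0) : exists z, [/\ D z, vcoord z <= v &
  forall z', D z' -> vcoord z' <= v -> vcoord z' <= vcoord z]; first exact.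
have [||z [Dz zv] zmax] := @finite_set_argmax _ _ _ vcoord (D `&` [set z | vcoord z <= v]).
- exact: finite_setIl.
- by exists z0.
by exists z; split=> // y Dy yv; exact: zmax.
Qed.

Lemma right_sampleP v : (exists2 z, D z & v <= vcoord z) ->
  [/\ D (right_sample v), v <= vcoord (right_sample v) &
    forall z, D z -> v <= vcoord z -> vcoord (right_sample v) <= vcoord z].
Proof.
move=> [z0 Dz0 z0v]; suff /(xgetPex 0) : exists z, [/\ D z, v <= vcoord z &
  forall z', D z' -> v <= vcoord z' -> vcoord z <= vcoord z']; first exact.
have [||z [Dz zv] zmax] :=
    @finite_set_argmax _ _ _ (fun z => - vcoord z) (D `&` [set z | v <= vcoord z]).
- exact: finite_setIl.
- by exists z0.
by exists z; split=> // y Dy yv; rewrite -lerN2; exact: zmax.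
Qed.

(** Each neighbour alone gives bounds that differ by twice its distance to [v]. Averaging the two
    differences bounds the gap by the distance between the neighbours, which lie between [x] and
    [y]. *)
Lemma gap_le_vcoordB v x y : D x -> D y -> vcoord x <= v <= vcoord y ->
  gap v <= vcoord y - vcoord x.
Proof.
move=> Dx Dy /andP[xv vy].
have [|_ lv /(_ x Dx xv) xl] := left_sampleP v; first by exists x.
have [|_ vr /(_ y Dy vy) ry] := right_sampleP v; first by exists y.
have normr_l : `|v - vcoord (left_sample v)| = v - vcoord (left_sample v).
  by rewrite ger0_norm ?subr_ge0.
have normr_r : `|v - vcoord (right_sample v)| = vcoord (right_sample v) - v.
  by rewrite ler0_norm ?subr_le0// opprB.
rewrite /gap /upper_bound /lower_bound normr_l normr_r.
have min_le (a b : R) : Num.min a b <= a /\ Num.min a b <= b.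
  by rewrite !ge_min !lexx orbT.
have le_max (a b : R) : a <= Num.max a b /\ b <= Num.max a b.
  by rewrite !le_max !lexx orbT.
set ul := qcoord _ + _; set ur := qcoord _ + _.
set ll := qcoord _ - _; set lr := qcoord _ - _.
have [] := min_le ul ur; have [] := le_max ll lr.
move: (Num.min _ _) (Num.max _ _) => u l; rewrite /ul /ur /ll /lr; lra.
Qed.

Lemma bounds_sampled z : D z ->
  upper_bound (vcoord z) = qcoord z /\ lower_bound (vcoord z) = qcoord z.
Proof.
move=> Dz; have [|Dl lz zl] := left_sampleP (vcoord z); first by exists z.
have [|Dr zr rz] := right_sampleP (vcoord z); first by exists z.
have lE : left_sample (vcoord z) = z.
  by apply: pareto_vcoord_inj; [exact: DP|exact: DP|apply/le_anti; rewrite lz zl].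
have rE : right_sample (vcoord z) = z.
  by apply: pareto_vcoord_inj; [exact: DP|exact: DP|apply/le_anti; rewrite rz// zr].
by rewrite /upper_bound /lower_bound lE rE subrr normr0 minxx maxxx addr0 subr0.
Qed.

(** Both inequalities are strict because [pareto_qcoord_lt] is, applied to [z] and each neighbouring
    sample. *)
Lemma bounds_unsampled z : P z -> ~ D z ->
  lower_bound (vcoord z) < qcoord z < upper_bound (vcoord z).
Proof.
move=> Pz Dz; have /andP[z1 z2] := anchor_vcoord_le z Pz.
have [|Dl _ _] := left_sampleP (vcoord z); first by exists a1.
have [|Dr _ _] := right_sampleP (vcoord z); first by exists a2.
have sep y : D y -> qcoord y - `|vcoord z - vcoord y| < qcoord z
    /\ qcoord z < qcoord y + `|vcoord z - vcoord y|.
  move=> Dy; have : `|qcoord z - qcoord y| < `|vcoord z - vcoord y|.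
    by apply: pareto_qcoord_lt => //; [exact: DP|apply/eqP => zy; rewrite zy in Dz].
  by rewrite ltr_norml => /andP[]; split; lra.
rewrite /upper_bound /lower_bound gt_max lt_min.
by have [-> ->] := sep _ Dl; have [-> ->] := sep _ Dr.
Qed.

Lemma gap_sampled z : D z -> gap (vcoord z) = 0.
Proof. by move=> /bounds_sampled[]; rewrite /gap => -> ->; rewrite subrr. Qed.

Lemma gap_unsampled z : P z -> ~ D z -> 0 < gap (vcoord z).
Proof.
by move=> Pz /(bounds_unsampled _ Pz)/andP[h1 h2]; rewrite subr_gt0; exact: lt_trans h2.
Qed.

Lemma stopping_test_gap v : stopping_test d1 d2 a1 a2 D -> vrange v ->
  gap v <= 2 * Num.sqrt 2.
Proof.
move=> stop vv; apply: le_trans stop; apply: ub_le_sup; last by exists v.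
(* An upper bound of the gaps is needed for [sup] to dominate them; the two anchors provide one. *)
exists (vcoord a2 - vcoord a1) => _ [w + <-]; rewrite /vrange /= in_itv /= => ww.
exact: gap_le_vcoordB.
Qed.

(** The stopping test is a weak inequality. Strictness comes from [bounds_unsampled], or, at a
    sample, from the error being 0. *)
Lemma central_error z : stopping_test d1 d2 a1 a2 D -> P z ->
  `|central d1 d2 D (vcoord z) - qcoord z| < Num.sqrt 2.
Proof.
move=> stop Pz; have := stopping_test_gap (vcoord z) stop.
rewrite /vrange /= in_itv /= anchor_vcoord_le// => /(_ isT).
rewrite /gap /central => gap_le.
have [Dz|Dz] := pselect (D z).
  have [-> ->] := bounds_sampled z Dz.
  by rewrite (_ : _ - _ = 0) ?normr0 ?sqrt2_gt0//; field.
have /andP[] := bounds_unsampled _ Pz Dz; move: gap_le.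
by rewrite ltr_norml => *; apply/andP; split; lra.
Qed.

(** Every [v] then lies in a cell whose two ends are sampled, and cells are short by [Mc_spec]. *)
Lemma stopping_test_grid :
  (forall v, grid d1 d2 a1 a2 v -> exists2 z, D z & vcoord z = v) ->
  stopping_test d1 d2 a1 a2 D.
Proof.
have [m [m_gt0 McE Lm]] := Mc_spec.
(* Indices 0 and [m] lie outside the grid; they correspond to the anchors. *)
move=> gridD; have endpoints r : (r <= m)%N ->
    exists2 z, D z & vcoord z = grid_value d1 d2 a1 a2 r.
  case: r => [_|r].
    by exists a1; rewrite // /grid_value mul0r addr0.
  rewrite leq_eqVlt => /predU1P[rm|rm].
    exists a2; rewrite // /grid_value McE addrK rm.
    by rewrite mulrCA divff ?mulr1 ?subrKC// pnatr_eq0 -lt0n.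
  by apply: gridD; exists r.+1 => //=; rewrite McE; lia.
have m0 : 0 < m%:R :> R by rewrite ltr0n.
apply: ge_sup.
  exists (gap (vcoord a1)), (vcoord a1) => //.
  have /andP[_ L0] := anchor_vcoord_le _ (DP _ Da1).
  by rewrite /vrange /= in_itv /= lexx.
move=> _ [v + <-]; rewrite /vrange /= in_itv /= => /andP[va av].
(* The right endpoint is treated apart: truncation would give it index [m], with no cell to its
   right. *)
move: av; rewrite le_eqVlt => /predU1P[->|av].
  apply: le_trans (gap_le_vcoordB _ _ _ Da2 Da2 _) _; first by rewrite lexx.
  by rewrite subrr mulr_ge0// ltW// sqrt2_gt0.
pose s := (vcoord a2 - vcoord a1) / m%:R.
have s_gt0 : 0 < s by rewrite divr_gt0// subr_gt0 (le_lt_trans va av).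
have s_le : s <= 2 * Num.sqrt 2 by rewrite ler_pdivrMr// mulrC.
have gridE r : grid_value d1 d2 a1 a2 r = vcoord a1 + r%:R * s.
  by rewrite /grid_value McE addrK.
have /truncn_itv/andP[] : 0 <= (v - vcoord a1) / s by rewrite divr_ge0 ?subr_ge0// ltW.
set r := Num.truncn _; rewrite ler_pdivlMr// ltr_pdivrMr// => rv vr.
have rm : (r < m)%N.
  rewrite -(ltr_nat R) -(ltr_pM2r s_gt0); apply: le_lt_trans rv _.
  by rewrite /s mulrCA divff ?gt_eqF// mulr1 ltrD2r.
have [x Dx xE] := endpoints _ (ltnW rm); have [y Dy yE] := endpoints _ rm.
apply: le_trans (gap_le_vcoordB _ _ _ Dx Dy _) _; rewrite xE yE !gridE.
  by apply/andP; split; lra.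
by rewrite -natr1; lra.
Qed.

End Samples.

(** * The loop: invariant, iteration count and progress *)

(** The list [s] records the grid indices selected so far. Its lack of repetition turns the
    iteration count into a count of grid values, and the offset 2 stands for the anchor
    iterations. *)
Definition robbo_invariant k D : Prop :=
  [/\ finite_set D, D `<=` P, D a1, D a2 &
    exists s : seq nat, [/\ uniq s, k = (size s).+2 & forall r, r \in s ->
      1 <= r%:Z <= Mc d1 d2 a1 a2 - 2 /\
      exists2 z, D z & vcoord z = grid_value d1 d2 a1 a2 r]].

Local Notation robbo_step := (robbo_step f S d1 d2 a1 a2).
Local Notation stopping_test := (stopping_test d1 d2 a1 a2).
Local Notation grid := (grid d1 d2 a1 a2).

Lemma unsampled_grid_value D : finite_set D -> D `<=` P -> D a1 -> D a2 ->
  ~ stopping_test D -> exists2 v, grid v & forall z, D z -> vcoord z <> v.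
Proof.
move=> Dfin DP D1 D2 nstop; apply: contrapT => nex; apply: nstop.
apply: stopping_test_grid => // v gv; apply: contrapT => nz; apply: nex.
by exists v => // z Dz zv; apply: nz; exists z.
Qed.

Lemma grid_vrange v : grid v -> vrange d1 d2 a1 a2 v.
Proof.
have [m [m_gt0 McE _]] := Mc_spec; have m0 : 0 < m%:R :> R by rewrite ltr0n.
have [P1 _] := a1_anchor; have /andP[_ L0] := anchor_vcoord_le a1 P1.
move=> [r /=]; rewrite McE => rm <-.
have rm' : (r <= m)%N by lia.
rewrite /vrange /= in_itv /= /grid_value McE addrK lerDl mulr_ge0 ?divr_ge0 ?subr_ge0//=.
rewrite -lerBrDl -mulrCA -[leRHS]mulr1 ler_wpM2l ?subr_ge0// ler_pdivrMr// mul1r.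
by rewrite ler_nat.
Qed.

Lemma robbo_invariant_step k D D' :
  robbo_invariant k D -> robbo_step D D' -> robbo_invariant k.+1 D'.
Proof.
move=> [Dfin DP D1 D2 [s [s_uniq kE sP]]] [nstop [v [x [z [sel _ _ zE D'E]]]]].
have [[r rM rv] vmax _ _] := sel.
have gv : grid v by exists r.
have vv := grid_vrange _ gv.
have Pz : P z by rewrite zE; exact: pf_point_front.
have vz : vcoord z = v by rewrite zE of_vqK_v.
rewrite {}D'E; split.
- by rewrite finite_setU.
- by move=> y [/DP//|->].
- by left.
- by left.
exists (r :: s); split; last 2 first.
- by rewrite kE.
- move=> r'; rewrite in_cons => /predU1P[->|/sP[r'M [y Dy yE]]].
    by split=> //; exists z; [right|rewrite vz].
  by split=> //; exists y; [left|].
(* If [r] had been selected before, the gap at [v] would be 0, while an unsampled grid value has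
   positive gap, against the maximality of [v]. *)
rewrite /= s_uniq andbT; apply/negP => /sP[_ [y Dy yE]].
have [w gw nw] := unsampled_grid_value _ Dfin DP D1 D2 nstop.
have := vmax _ gw; rewrite -rv -yE gap_sampled// leNgt => /negP; apply.
have [u Pu uw] := pareto_vrange _ (grid_vrange _ gw).
by rewrite -uw; apply: gap_unsampled => // /nw.
Qed.

Lemma robbo_runP k D : robbo_run f S d1 d2 a1 a2 k D -> robbo_invariant k D.
Proof.
elim=> [|{}k {}D D' _ inv step]; last exact: robbo_invariant_step step.
have [P1 _] := a1_anchor; have [P2 _] := a2_anchor.
split; [by []|by move=> y [->|->]|by left|by right|].
by exists [::].
Qed.

(** The indices in [s] are distinct and range over 1, ..., [m - 1]. *)
Lemma robbo_invariant_le k D : robbo_invariant k D -> k%:Z <= Mc d1 d2 a1 a2.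
Proof.
move=> [_ _ _ _ [s [s_uniq -> sP]]]; have [m [m_gt0 McE _]] := Mc_spec.
have : (size s <= size (iota 1 m.-1))%N.
  apply: uniq_leq_size => // r /sP[+ _]; rewrite McE mem_iota; lia.
by rewrite size_iota McE; lia.
Qed.

Lemma finite_grid : finite_set grid.
Proof.
have [m [_ McE _]] := Mc_spec.
apply: (sub_finite_set _ (finite_image (grid_value d1 d2 a1 a2) (finite_seq (iota 1 m)))).
by move=> _ [r /= rM <-]; exists r => //=; move: rM; rewrite McE mem_iota; lia.
Qed.

(** The tie-breaking rule is lexicographic, so three nested maximizations over finite sets realize
    it. *)
Lemma selected_exists D : grid !=set0 -> exists v, selected d1 d2 a1 a2 D v.
Proof.
move=> grid0; pose g := gap d1 d2 D; pose dist := sample_dist d1 d2 D.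
have [v1 gv1 max1] := finite_set_argmax g _ finite_grid grid0.
pose A2 := grid `&` [set w | g w = g v1].
have A2fin : finite_set A2 by apply: finite_setIl; exact: finite_grid.
have [|v2 [gv2 v21] max2] := finite_set_argmax dist _ A2fin; first by exists v1.
pose A3 := A2 `&` [set w | dist w = dist v2].
have A3fin : finite_set A3 by exact: finite_setIl.
have [|v3 [[gv3 v31] v32] max3] := finite_set_argmax (fun w => - w) _ A3fin.
  by exists v2.
exists v3; split=> // w gw.
- by rewrite -/(g v3) v31; exact: max1.
- by rewrite -/(g v3) v31 -/(dist v3) v32 => gwE; exact: max2.
- rewrite -/(g v3) v31 -/(dist v3) v32 => gwE dwE.
  by rewrite -lerN2; exact: max3.
Qed.

(** The constraint fixes the v-coordinate. The objective then increases with q, and the front point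
    has the least q by [pareto_qcoord_min]. *)
Lemma subproblem_solvable v : vrange d1 d2 a1 a2 v ->
  exists2 x, subproblem_solution f S d1 d2 v x & f x = pf_point v.
Proof.
move=> vv; have Pz := pf_point_front _ vv; have [[x Sx fx] _] := Pz.
have feasE y : d2 * f y 0 0 - d1 * f y 1 0 - 2 * d1 * d2 / Num.sqrt 2 * v
    = 2 * d1 * d2 / Num.sqrt 2 * (vcoord (f y) - v).
  rewrite (coord0_vq (f y)) (coord1_vq (f y)).
  by field; rewrite gt_eqF ?sqrt2_gt0.
have c0 : 2 * d1 * d2 / Num.sqrt 2 != 0.
  by rewrite gt_eqF// divr_gt0 ?sqrt2_gt0// !mulr_gt0.
exists x => //; split=> [|y [Sy]].
  by split=> //; rewrite feasE fx of_vqK_v subrr mulr0.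
rewrite feasE => /eqP; rewrite mulf_eq0 (negbTE c0) subr_eq0 /= => /eqP yv.
have vfx : vcoord (f x) = v by rewrite fx of_vqK_v.
have : qcoord (f x) <= qcoord (f y).
  by apply: pareto_qcoord_min; [rewrite fx|exists y|rewrite yv vfx].
rewrite !(coord0_vq (f _)) !(coord1_vq (f _)) vfx yv => q_le.
by apply: lerD; rewrite ler_pM2l// ler_pM2r ?invr_gt0 ?sqrt2_gt0// ler_pM2l// lerD2r.
Qed.

Lemma robbo_progress k D : robbo_invariant k D -> ~ stopping_test D ->
  exists D', robbo_step D D'.
Proof.
move=> [Dfin DP D1 D2 _] nstop.
have [w gw _] := unsampled_grid_value _ Dfin DP D1 D2 nstop.
have [|v sel] := @selected_exists D; first by exists w.
have [gv _ _ _] := sel; have [x xsol fx] := subproblem_solvable _ (grid_vrange _ gv).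
by exists (D `|` [set f x]); split=> //; exists v, x, (f x).
Qed.

End Front.

End Coordinates.

Theorem mainTheorem6 (R : realType) (n : nat)
    (f : 'cV[R]_n -> 'cV[R]_2) (S : set 'cV[R]_n)
    (delta1 delta2 : R) (delta1_gt0 : 0 < delta1) (delta2_gt0 : 0 < delta2)
    (PF_curve : continuous_compact_curve (pareto_front f S))
    (a1 a2 : 'cV[R]_2)
    (a1_anchor : anchor f S 0 a1) (a2_anchor : anchor f S 1 a2)
    (a1_neq_a2 : a1 != a2) :
  robbo_terminates_within f S delta1 delta2 a1 a2 (Mc delta1 delta2 a1 a2) /\
  forall Phat : set 'cV[R]_2,
    robbo_returns f S delta1 delta2 a1 a2 Phat ->
    forall zhat : 'cV[R]_2, Phat zhat ->
      let zstar := realization delta1 delta2 (pareto_front f S) zhat in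
      let eps := zhat - zstar in
      pareto_front f S zstar /\
      `|eps 0 0| < delta1 /\ `|eps 1 0| < delta2.
Proof.
split.
  split=> k D /(robbo_runP delta1_gt0 delta2_gt0 a1_anchor a2_anchor PF_curve a1_neq_a2) inv.
    exact: (robbo_invariant_le delta1_gt0 delta2_gt0 a1_anchor a2_anchor a1_neq_a2 _ _ inv).
  exact: (robbo_progress delta1_gt0 delta2_gt0 a1_anchor a2_anchor PF_curve a1_neq_a2 _ _ inv).
move=> _ [k [D [/(robbo_runP delta1_gt0 delta2_gt0 a1_anchor a2_anchor PF_curve a1_neq_a2)
  [Dfin DP D1 D2 _] stop ->]]] _ [v vv <-] zstar eps.
have zstarE : zstar = @pf_point R delta1 delta2 n f S v.
  by rewrite /zstar /realization of_vqK_v.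
have Pz : pareto_front f S zstar.
  rewrite zstarE.
  exact: (pf_point_front delta1_gt0 delta2_gt0 a1_anchor a2_anchor PF_curve _ vv).
have vz : vcoord delta1 delta2 zstar = v by rewrite zstarE of_vqK_v.
have := central_error delta1_gt0 delta2_gt0 a1_anchor a2_anchor Dfin DP D1 D2 _ stop Pz.
rewrite vz => err; split; first exact: Pz.
(* Written through [of_vq], [zstar] has the same v-coordinate as the estimate, so only the q-error
   [err] remains. *)
rewrite /eps -(vqcoordK delta1_gt0 delta2_gt0 zstar) vz.
exact: (of_vqB_lt delta1_gt0 delta2_gt0).
Qed.
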